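(* Let $p\in[1,\infty)$, let $X$ be a Banach space, and let $f:\mathbb{R}\times X\to X$ be continuous in its second argument and such that $f(\cdot,x)\in L^p_{loc}(\mathbb{R},X)$ for each $x\in X$. Then $f\in AAS^pU(\mathbb{R}\times X,X)$ if and only if the following two conditions hold: (i) for each $x\in X$, $f(\cdot,x)\in AAS^p(\mathbb{R},X)$; (ii) $f$ is $S^p$-uniformly continuous with respect to the second argument on each compact subset of $X$, that is: for every compact $K\subset X$ and every $\varepsilon>0$ there exists $\delta_{K,\varepsilon}>0$ such that for all $x_1,x_2\in K$, $$\|x_1-x_2\|\le\delta_{K,\varepsilon}\ \Longrightarrow\ \Big(\int_t^{t+1}\|f(s,x_1)-f(s,x_2)\|^p\,ds\Big)^{1/p}\le\varepsilon\quad\text{for all }t\in\mathbb{R}.$$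
   Context: $AAS^p(\mathbb{R},X)$ ($S^p$-almost automorphic functions): the set of $u\in L^p_{loc}(\mathbb{R},X)$ such that every real sequence has a subsequence $(s_n)$ and a function $v\in L^p_{loc}(\mathbb{R},X)$ with, for each $t\in\mathbb{R}$, $\lim_n\big(\int_t^{t+1}\|u(s+s_n)-v(s)\|^pds\big)^{1/p}=0$ and $\lim_n\big(\int_t^{t+1}\|v(s-s_n)-u(s)\|^pds\big)^{1/p}=0$. $AAS^pU(\mathbb{R}\times X,X)$: functions $f:\mathbb{R}\times X\to X$ with $f(\cdot,x)\in L^p_{loc}(\mathbb{R},X)$ for each $x\in X$ such that for each compact $K\subset X$ and every real sequence $(\sigma_n)$ there are a subsequence $(s_n)$ and a function $g$ with $g(\cdot,x)\in L^p_{loc}(\mathbb{R},X)$ for each $x\in X$, such that for each $t\in\mathbb{R}$, $\lim_n\sup_{x\in K}\big(\int_t^{t+1}\|f(s+s_n,x)-g(s,x)\|^pds\big)^{1/p}=0$ and $\lim_n\sup_{x\in K}\big(\int_t^{t+1}\|g(s-s_n,x)-f(s,x)\|^pds\big)^{1/p}=0$. *)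

(* Defs.v *)
From HB Require Import structures.
From mathcomp Require Import all_boot all_order all_algebra.
From mathcomp Require Import all_classical all_reals all_analysis.
Set Implicit Arguments.
Unset Strict Implicit.
Unset Printing Implicit Defensive.
Import Order.TTheory GRing.Theory Num.Theory.
Import numFieldNormedType.Exports.
Local Open Scope classical_set_scope.
Local Open Scope ring_scope.

Section StepanovSpaces.
Context {R : realType} {X : completeNormedModType R}.
Local Notation mu := (@lebesgue_measure R).

Definition simple_fun (phi : R -> X) : Prop :=
  finite_set (range phi) /\ forall x : X, measurable (phi @^-1` [set x]).

(* Strong (Bochner) measurability.  [measurable] above means Borel, but every
   Lebesgue measurable simple function agrees almost everywhere with a Borel
   one, so almost everywhere limits of either kind of simple functions are the
   same. *)
Definition strongly_measurable (u : R -> X) : Prop :=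
  exists phi : (R -> X)^nat, (forall n, simple_fun (phi n)) /\
    {ae mu, forall s, phi ^~ s @ \oo --> u s}.

(* If [u] is strongly measurable then [`|u s| `^ p] is Lebesgue but maybe not
   Borel measurable.  The library integral of a nonnegative function is the
   supremum of the integrals of the Borel simple functions below it, which for
   a Lebesgue measurable function is the usual Lebesgue integral. *)
Definition Lploc (p : R) : set (R -> X) :=
  [set u | strongly_measurable u /\
    forall K : set R, compact K ->
      (\int[mu]_(s in K) (`|u s| `^ p)%:E < +oo)%E].

Definition Sp_norm (p t : R) (u : R -> X) : \bar R :=
  ((\int[mu]_(s in `[t, (t + 1)%R]) (`|u s| `^ p)%:E) `^ p^-1)%E.

Definition AASp (p : R) : set (R -> X) :=
  [set u | Lploc p u /\
    forall sigma : R^nat,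
      exists (k : nat -> nat) (v : R -> X),
        [/\ {homo k : m n / (m < n)%N}, Lploc p v &
          forall t : R,
            Sp_norm p t (fun s => u (s + sigma (k n)) - v s)
              @[n --> \oo] --> 0%E /\
            Sp_norm p t (fun s => v (s - sigma (k n)) - u s)
              @[n --> \oo] --> 0%E]].

(* Supremum over K in [0, +oo]: adding 0 only matters for K = set0, where
   [ereal_sup set0] would be -oo. *)
Definition sup_over (K : set X) (N : X -> \bar R) : \bar R :=
  ereal_sup (0%E |` [set N x | x in K]).

Definition AASpU (p : R) : set (R -> X -> X) :=
  [set f | (forall x : X, Lploc p (f ^~ x)) /\
    forall K : set X, compact K ->
    forall sigma : R^nat,
      exists (k : nat -> nat) (g : R -> X -> X),
        [/\ {homo k : m n / (m < n)%N}, forall x : X, Lploc p (g ^~ x) &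
          forall t : R,
            sup_over K
              (fun x => Sp_norm p t (fun s => f (s + sigma (k n)) x - g s x))
              @[n --> \oo] --> 0%E /\
            sup_over K
              (fun x => Sp_norm p t (fun s => g (s - sigma (k n)) x - f s x))
              @[n --> \oo] --> 0%E]].

Definition Sp_uniformly_continuous_on_compacts (p : R) (f : R -> X -> X) :
    Prop :=
  forall K : set X, compact K ->
  forall e : R, 0 < e ->
    exists2 d : R, 0 < d &
      forall x1 x2 : X, K x1 -> K x2 -> `|x1 - x2| <= d ->
        forall t : R, (Sp_norm p t (fun s => (f s x1 - f s x2)%R) <= e%:E)%E.

End StepanovSpaces.

(* Main.v *)
Require Import Defs.
From HB Require Import structures.
From mathcomp Require Import all_boot all_order all_algebra.
From mathcomp Require Import all_classical all_reals all_analysis.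
From mathcomp Require Import measurable_realfun finmap ring lra.
Import Order.TTheory GRing.Theory Num.Theory.
Import numFieldNormedType.Exports.
Local Open Scope classical_set_scope.
Local Open Scope ring_scope.

(* The difficult point is that a function f of AAS^pU is continuous as a map
   from K to L^p of a window, although f(s, .) is only continuous for each s:
   if f(., x) carries a bump that narrows as x varies, this fails.  Let x_n and
   y_n converge to the same point of K, so that w_n = |f(., x_n) - f(., y_n)|
   tends to 0 pointwise, and suppose that the L^p norms of the w_n stay above e.
   Call a and b in [0, 1] close if the translates of w_n by a and b are at a
   small L^p distance for all n.  For each b, the set S_b of the a close to b is
   null: otherwise, averaging over a in S_b, Tonelli's theorem and the almost
   uniform convergence of w_n to 0 would make the norm of a translate of some w_n
   small.  Hence there is a sequence in [0, 1] whose terms are pairwise not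
   close, and the translates of f along it have no subsequence converging in
   L^p uniformly over K.  Given this continuity, (ii) follows by applying the
   definition of AAS^pU to the translations t_n of a would-be counterexample.

   Conversely, under (i) and (ii) extract diagonally a subsequence along which
   the translates of f(., y) converge for all y in finite nets of K.  For each x
   the limit g(., x) is the one that (i) provides along a further subsequence, so
   the completeness of L^p plays no role; (ii) makes the convergence uniform
   over K along the whole subsequence. *)

(** * Monotonicity of integrals of nonnegative functions *)

Section integral_monotonicity.
Import HBNNSimple.

(* No measurability is needed: the integral of a nonnegative function is the
   supremum of the integrals of the simple functions below it, and these may be
   set to 0 on a null set. *)
Lemma ae_le_ge0_integral d (T : measurableType d) (R : realType)
    (m : {measure set T -> \bar R}) (D : set T) (f g : T -> \bar R) :
  measurable D ->
  (forall x, D x -> (0 <= f x)%E) -> (forall x, D x -> (0 <= g x)%E) ->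
  {ae m, forall x, D x -> (f x <= g x)%E} ->
  (\int[m]_(x in D) f x <= \int[m]_(x in D) g x)%E.
Proof.
move=> mD f0 g0 [N [mN N0 fgN]].
rewrite ge0_integralE// ge0_integralE//.
apply: ge_ereal_sup => _ [h hf <-].
have mNC : measurable (~` N) by exact: measurableC.
have -> : sintegral m h = sintegral m (proj_nnsfun h mNC).
  rewrite -!integralT_nnsfun (@ge0_negligible_integral _ _ _ _ _ N)//.
  - rewrite setTD integral_mkcond; apply: eq_integral => x _ /=.
    by rewrite patchE mindicE; case: ifPn => _; rewrite ?mulr1 ?mulr0.
  - exact/measurable_EFinP.
  - by move=> x _; rewrite lee_fin.
apply: ereal_sup_ubound; exists (proj_nnsfun h mNC) => //= x.
rewrite mindicE; have [xN|xN] := boolP (x \in ~` N); last first.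
  by rewrite mulr0 erestrict_ge0.
rewrite mulr1 (le_trans (hf x))// !patchE; case: ifPn => // /set_mem xD.
apply: contrapT => fg; move/set_mem: xN; apply; apply: fgN => /=.
by move=> /(_ xD).
Qed.

Lemma ae_eq_ge0_integral d (T : measurableType d) (R : realType)
    (m : {measure set T -> \bar R}) (D : set T) (f g : T -> \bar R) :
  measurable D ->
  (forall x, D x -> (0 <= f x)%E) -> (forall x, D x -> (0 <= g x)%E) ->
  {ae m, forall x, D x -> f x = g x} ->
  (\int[m]_(x in D) f x = \int[m]_(x in D) g x)%E.
Proof.
move=> mD f0 g0 fg; apply/eqP; rewrite eq_le; apply/andP; split.
  by apply: ae_le_ge0_integral => //; apply: filterS fg => x + Dx => ->.
by apply: ae_le_ge0_integral => //; apply: filterS fg => x + Dx => ->.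
Qed.

End integral_monotonicity.

Lemma le_ge0_integral d (T : measurableType d) (R : realType)
    (m : {measure set T -> \bar R}) (D : set T) (f g : T -> \bar R) :
  measurable D -> (forall x, D x -> (0 <= f x)%E) ->
  (forall x, D x -> (f x <= g x)%E) ->
  (\int[m]_(x in D) f x <= \int[m]_(x in D) g x)%E.
Proof.
move=> mD f0 fg; apply: ae_le_ge0_integral => //; last exact: aeW.
by move=> x Dx; exact: le_trans (f0 x Dx) (fg x Dx).
Qed.

Lemma ae_imply d (T : measurableType d) (R : realType)
    (m : {measure set T -> \bar R}) (P Q : T -> Prop) :
  (forall x, P x -> Q x) -> {ae m, forall x, P x} -> {ae m, forall x, Q x}.
Proof. by move=> PQ; apply: filterS. Qed.

Lemma ae_imply2 d (T : measurableType d) (R : realType)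
    (m : {measure set T -> \bar R}) (P Q S : T -> Prop) :
  (forall x, P x -> Q x -> S x) ->
  {ae m, forall x, P x} -> {ae m, forall x, Q x} -> {ae m, forall x, S x}.
Proof. by move=> PQS; apply: filterS2. Qed.

(** * Translation invariance of Lebesgue measure *)

Section shift.
Context {R : realType}.
Local Notation mu := (@lebesgue_measure R).

Lemma measurable_shift (a : R) : measurable_fun [set: R] (fun s : R => s + a).
Proof. exact: measurable_funD. Qed.

Let shift_measure (a : R) : {measure set (measurableTypeR R) -> \bar R} :=
  @measure_function_pushforward__canonical__measure_function_Measure _ _
    (measurableTypeR R) (measurableTypeR R) R mu _ (measurable_shift a).

(** The pushforward of [mu] under a translation gives half-open intervals their length, and Lebesgue
    measure is the only measure that does. *)
Lemma lebesgue_measure_shift (a : R) (A : set R) : measurable A ->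
  mu ((fun s => s + a) @^-1` A) = mu A.
Proof.
move=> mA; suff H X : ocitv X -> mu X = shift_measure a X.
  exact/esym/(lebesgue_measure_unique H mA).
move=> [[x y] _ <-]; rewrite /= /pushforward.
rewrite (_ : _ @^-1` _ = `](x - a), (y - a)]%classic); last first.
  by apply/seteqP; split => s /=; rewrite !in_itv/= ltrBlDr lerBrDr.
rewrite !lebesgue_measure_itv/= !lte_fin ltrD2r.
by case: ifPn => // _; rewrite -!EFinB opprB addrA subrK.
Qed.

Lemma ae_shift (a : R) (P : R -> Prop) :
  {ae mu, forall s, P s} -> {ae mu, forall s, P (s + a)}.
Proof.
move=> [N [mN N0 PN]]; exists ((fun s => s + a) @^-1` N); split.
- by rewrite -[X in measurable X]setTI; exact: measurable_shift.
- by have := lebesgue_measure_shift a N mN; rewrite N0.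
- by move=> s /= Ps; exact: PN.
Qed.

Lemma ge0_integral_shift (a t : R) (f : R -> \bar R) :
  measurable_fun [set: R] f -> (forall s, 0 <= f s)%E ->
  (\int[mu]_(s in `[t, (t + 1)%R]) f (s + a)%R =
   \int[mu]_(s in `[(t + a)%R, (t + a + 1)%R]) f s)%E.
Proof.
move=> mf f0.
have mI : measurable `[(t + a)%R, (t + a + 1)%R]%classic by [].
have := @ge0_integral_pushforward _ _ (measurableTypeR R) (measurableTypeR R) R
  _ (measurable_shift a) mu _ f mI (measurable_funTS mf) (fun s _ => f0 s).
rewrite (_ : _ @^-1` _ = `[t, t + 1]%classic) => [<-|]; last first.
  by apply/seteqP; split => s /=; rewrite !in_itv/= lerD2r (addrAC t) lerD2r.
apply: (eq_measure_integral mu (m1 := shift_measure a)) => A mA _.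
exact: lebesgue_measure_shift.
Qed.

End shift.

(** * Strong measurability: differences, translates and norms *)

Section strong_measurability.
Context {R : realType} {X : completeNormedModType R}.
Local Notation mu := (@lebesgue_measure R).
Implicit Types u v phi psi : R -> X.

(** The preimage is the finite union of the level sets of [phi] at those of its values that [h]
    sends into [B]. *)
Lemma simple_fun_comp1 (V : Type) phi (h : X -> V) (B : set V) :
  simple_fun phi -> measurable ((h \o phi) @^-1` B).
Proof.
move=> [fphi mphi].
rewrite (_ : _ @^-1` B =
    \bigcup_(x in range phi `&` h @^-1` B) phi @^-1` [set x]).
  by apply: fin_bigcup_measurable => //; exact: finite_setIl.
by apply/seteqP; split => s /= => [Bs|[x [_ Bx] ->]//]; exists (phi s).
Qed.

Lemma simple_funB phi psi : simple_fun phi -> simple_fun psi ->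
  simple_fun (fun s => phi s - psi s).
Proof.
move=> sphi [fpsi mpsi]; split.
  apply: (@sub_finite_set _ _
      ((fun z => z.1 - z.2) @` (range phi `*` range psi))).
    by move=> _ [s _ <-]; exists (phi s, psi s) => //=; split; exists s.
  by apply: finite_image; apply: finite_setX => //; case: sphi.
move=> x; rewrite (_ : _ @^-1` _ = \bigcup_(y in range psi)
    (psi @^-1` [set y] `&` (id \o phi) @^-1` [set x + y])).
  apply: fin_bigcup_measurable => // y _; apply: measurableI => //.
  exact: simple_fun_comp1.
apply/seteqP; split => s /= => [<-|[y _ [/= -> ->]]]; last by rewrite addrK.
by exists (psi s); rewrite // subrK.
Qed.

Lemma simple_fun_shift (a : R) phi : simple_fun phi ->
  simple_fun (fun s => phi (s + a)).
Proof.
move=> [fphi mphi]; split.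
  by apply: sub_finite_set fphi => _ [s _ <-]; exists (s + a).
move=> x; rewrite (_ : _ @^-1` _ =
  (fun s => s + a) @^-1` (phi @^-1` [set x]))// -[X in measurable X]setTI.
exact: measurable_shift.
Qed.

Lemma strongly_measurableB u v : strongly_measurable u ->
  strongly_measurable v -> strongly_measurable (fun s => u s - v s).
Proof.
move=> [phi [sphi phiu]] [psi [spsi psiv]].
exists (fun n s => phi n s - psi n s); split.
  by move=> n; exact: simple_funB.
by apply: ae_imply2 phiu psiv => s; exact: cvgB.
Qed.

Lemma strongly_measurable_shift (a : R) u : strongly_measurable u ->
  strongly_measurable (fun s => u (s + a)).
Proof.
move=> [phi [sphi phiu]].
exists (fun n s => phi n (s + a)); split.
  by move=> n; exact: simple_fun_shift.
exact: (ae_shift a (fun s => phi ^~ s @ \oo --> u s)).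
Qed.

(* [`|u s|] itself may fail to be Borel, so w is the representative to which
   Minkowski, Tonelli and Egorov are applied. *)
Lemma strongly_measurable_norm u : strongly_measurable u ->
  exists w : R -> R, [/\ measurable_fun [set: R] w, forall s, 0 <= w s &
    {ae mu, forall s, w s = `|u s|}].
Proof.
move=> [phi [sphi [N [mN N0 phiu]]]].
pose w s := `|u s| * \1_(~` N) s.
exists w; split.
- apply: (@measurable_fun_cvg _ _ _ setT
    (fun n s => `|phi n s| * \1_(~` N) s)) => //.
  + move=> n; apply: measurable_funM.
      by move=> _ B mB; rewrite setTI; exact: (simple_fun_comp1 _ (phi n)).
    exact/measurable_indic/measurableC.
  + move=> s _; rewrite /w indicE; have [sN|sN] := boolP (s \in ~` N).
      apply: cvgM; last exact: cvg_cst.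
      apply: cvg_norm; apply: contrapT => H.
      by move/set_mem: sN; apply; exact: phiu.
    rewrite mulr0; under eq_fun do rewrite mulr0; exact: cvg_cst.
- by move=> s; rewrite mulr_ge0.
- exists N; split => // s /= ws; apply: contrapT => sN; apply: ws.
  by rewrite /w indicE mem_set// mulr1.
Qed.

End strong_measurability.

(** * The Stepanov norm: Minkowski's inequality and translation *)

Section Stepanov_norm.
Context {R : realType} {X : completeNormedModType R}.
Local Notation mu := (@lebesgue_measure R).
Implicit Types (u v z : R -> X) (w : R -> R).

Lemma Sp_norm_ge0 (p t : R) u : (0 <= Sp_norm p t u)%E.
Proof. exact: poweR_ge0. Qed.

Lemma measurable_powR_EFin (p : R) w : measurable_fun [set: R] w ->
  measurable_fun [set: R] (fun s => (w s `^ p)%:E).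
Proof.
move=> mw; apply/measurable_EFinP.
exact: (measurableT_comp (measurable_powR p) mw).
Qed.

Lemma Sp_norm_integral (p t : R) u w : (forall s, 0 <= w s) ->
  {ae mu, forall s, w s = `|u s|} ->
  Sp_norm p t u = ((\int[mu]_(s in `[t, (t + 1)%R]) (w s `^ p)%:E) `^ p^-1)%E.
Proof.
move=> w0 wu; apply: (congr1 (fun x => x `^ p^-1)%E); apply: ae_eq_ge0_integral.
- by [].
- by move=> s _; rewrite lee_fin powR_ge0.
- by move=> s _; rewrite lee_fin powR_ge0.
- by move: wu; apply: ae_imply => s -> _.
Qed.

(** Minkowski's inequality concerns norms over the whole line, so the window is moved into the
    integrand as a restriction. *)
Lemma Sp_norm_Lnorm (p t : R) u w : (forall s, 0 <= w s) -> 0 < p ->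
  {ae mu, forall s, w s = `|u s|} ->
  Sp_norm p t u = ('N[mu]_(p%:E)[EFin \o (w \_ `[t, (t + 1)%R])])%E.
Proof.
move=> w0 p0 wu; rewrite (Sp_norm_integral _ _ _ _ w0 wu) unlock.
rewrite [in LHS]integral_mkcond; apply: (congr1 (fun x => x `^ p^-1)%E).
apply: eq_integral => s _ /=.
rewrite !patchE; case: ifPn => _; first by rewrite ger0_norm.
by rewrite normr0 powR0// gt_eqF.
Qed.

Lemma measurable_itv_restrict (t : R) w : measurable_fun [set: R] w ->
  measurable_fun [set: R] (w \_ `[t, (t + 1)%R]).
Proof.
by move=> mw; apply/(measurable_restrictT _ _).1 => //; exact: measurable_funTS.
Qed.

(** Minkowski's inequality for real representatives of the two norms. A pointwise dominated [z] lets
    one statement serve sums, differences and telescoping. *)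
Lemma Sp_norm_triangle (p t : R) u v z : 1 <= p ->
  strongly_measurable u -> strongly_measurable v ->
  (forall s, `|z s| <= `|u s| + `|v s|) ->
  (Sp_norm p t z <= Sp_norm p t u + Sp_norm p t v)%E.
Proof.
move=> p1 /strongly_measurable_norm[w1 [mw1 w10 w1u]].
move=> /strongly_measurable_norm[w2 [mw2 w20 w2v]] zuv.
have p0 : 0 < p by exact: lt_le_trans p1.
rewrite (Sp_norm_Lnorm _ t _ _ w10 p0 w1u) (Sp_norm_Lnorm _ t _ _ w20 p0 w2v).
have M := minkowski_EFin mu (measurable_itv_restrict t _ mw1)
  (measurable_itv_restrict t _ mw2) p1.
apply: (le_trans _ M).
rewrite (_ : (_ \+ _)%R = (w1 \+ w2) \_ `[t, (t + 1)%R])%R; last first.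
  by apply/funext => s /=; rewrite !patchE; case: ifPn => //; rewrite addr0.
pose w := w1 \+ w2; have w0 s : 0 <= w s by rewrite addr_ge0.
rewrite unlock; apply: gt0_ler_poweR.
- by rewrite invr_ge0 ltW.
- by rewrite in_itv/= leey andbT integral_ge0// => s _; rewrite lee_fin powR_ge0.
- by rewrite in_itv/= leey andbT integral_ge0// => s _; rewrite poweR_ge0.
rewrite [leLHS]integral_mkcond; apply: ae_le_ge0_integral.
- by [].
- by move=> s _; rewrite erestrict_ge0// => ? _; rewrite lee_fin powR_ge0.
- by move=> s _; rewrite poweR_ge0.
- apply: ae_imply2 w1u w2v => s E1 E2 _; rewrite /= !patchE; case: ifPn => _ /=.
    rewrite lee_fin ge0_ler_powR ?nnegrE ?(ltW p0)//.
    by rewrite ger0_norm ?addr_ge0// E1 E2.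
  by rewrite [leLHS](_ : _ = 0%E)// lee_fin powR_ge0.
Qed.

Lemma Sp_norm_distC (p t : R) u v :
  Sp_norm p t (fun s => u s - v s) = Sp_norm p t (fun s => v s - u s).
Proof. by rewrite /Sp_norm; under eq_integral do rewrite distrC. Qed.

Lemma Sp_norm_trans (p t : R) v u z : 1 <= p ->
  strongly_measurable u -> strongly_measurable v -> strongly_measurable z ->
  (Sp_norm p t (fun s => (u s - z s)%R) <= Sp_norm p t (fun s => (u s - v s)%R)
     + Sp_norm p t (fun s => (v s - z s)%R))%E.
Proof.
move=> p1 mu_u mv mz.
apply: Sp_norm_triangle => //; try exact: strongly_measurableB.
by move=> s; rewrite -[in leLHS](subrK (v s) (u s)) -addrA ler_normD.
Qed.

Lemma Sp_norm_shift (p t a : R) u : strongly_measurable u ->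
  Sp_norm p t (fun s => u (s + a)) = Sp_norm p (t + a) u.
Proof.
move=> /strongly_measurable_norm[w [mw w0 wu]].
have wua := ae_shift a (fun s => w s = `|u s|) wu.
have mwp := measurable_powR_EFin p _ mw.
have -> := Sp_norm_integral p (t + a) u w w0 wu.
have -> := Sp_norm_integral p t (fun s => u (s + a)) (fun s => w (s + a))
  (fun s => w0 _) wua.
have <- := ge0_integral_shift a t _ mwp (fun s => powR_ge0 _ _).
by [].
Qed.

End Stepanov_norm.

(** * Diagonal extraction, finite nets and limits equal to 0 *)

Section subsequences.

Lemma homo_ltn_ge (k : nat -> nat) : {homo k : m n / (m < n)%N} ->
  forall n, (n <= k n)%N.
Proof. by move=> hk; elim=> // n IH; exact: leq_ltn_trans IH (hk _ _ _). Qed.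

(** From index [i] on, the n-th diagonal term is a term of the i-th extraction, of index at least n.
    The second hypothesis asks that [P i] survive exactly this passage, whatever the first [i] terms
    are. *)
Lemma diagonal_subsequence (T : Type) (sigma : nat -> T)
    (P : nat -> (nat -> T) -> Prop) :
  (forall i tau, exists2 k : nat -> nat, {homo k : m n / (m < n)%N} &
     P i (tau \o k)) ->
  (forall i tau tau' (m : nat -> nat), P i tau ->
     (forall n, (i <= n)%N -> (n <= m n)%N /\ tau' n = tau (m n)) ->
     P i tau') ->
  exists2 k : nat -> nat, {homo k : m n / (m < n)%N} &
    forall i, P i (sigma \o k).
Proof.
move=> Pex Psub.
have [e eP] : exists e : nat -> (nat -> T) -> nat -> nat, forall i tau,
    {homo e i tau : m n / (m < n)%N} /\ P i (tau \o e i tau).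
  have /choice[e eP] : forall z : nat * (nat -> T), exists k : nat -> nat,
      {homo k : m n / (m < n)%N} /\ P z.1 (z.2 \o k).
    by move=> [i tau]; have [k] := Pex i tau; exists k.
  by exists (fun i tau => e (i, tau)) => i tau; exact: (eP (i, tau)).
pose fix K i := if i is i'.+1 then K i' \o e i'.+1 (sigma \o K i')
                else e 0%N sigma.
have Khomo i : {homo K i : m n / (m < n)%N}.
  elim: i => [|i IH] /=; first by case: (eP 0%N sigma).
  by move=> m n mn /=; apply: IH; case: (eP i.+1 (sigma \o K i)) => + _; apply.
have KP i : P i (sigma \o K i).
  case: i => [|i] /=; first by case: (eP 0%N sigma).
  by case: (eP i.+1 (sigma \o K i)).
have Kfact i d : exists2 m : nat -> nat, {homo m : a b / (a < b)%N} &
    K (d + i)%N = K i \o m.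
  elim: d => [|d [m mh Km]]; first by exists id.
  rewrite addSn /=; exists (m \o e (d + i).+1 (sigma \o K (d + i)%N)).
    move=> a b ab /=; apply: mh.
    by case: (eP (d + i).+1 (sigma \o K (d + i)%N)) => + _; apply.
  by rewrite Km.
exists (fun n => K n n).
  apply: homo_ltn; first exact: ltn_trans.
  (* [K n.+1 n.+1] is the value of [K n] at an index at least n + 1, hence exceeds [K n n]. *)
  move=> n /=; apply: Khomo; apply: leq_trans (ltnSn n) _.
  by apply: homo_ltn_ge; case: (eP n.+1 (sigma \o K n)).
move=> i.
have /choice[m mP] : forall n, exists q, (i <= n)%N ->
    (n <= q)%N /\ K n n = K i q.
  move=> n; have [m mh Km] := Kfact i (n - i)%N.
  exists (m n) => iln; split; first exact: homo_ltn_ge.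
  by move: Km; rewrite subnK// => ->.
apply: (Psub i (sigma \o K i) _ m) => // n iln.
by have [nm KE] := mP n iln; split; rewrite //= KE.
Qed.

End subsequences.

Lemma compact_net {R : realType} {X : normedModType R} (K : set X) (d : R) :
  compact K -> 0 < d ->
  exists2 s : seq X, (forall x, x \in s -> K x) &
    forall y, K y -> exists2 x, x \in s & `|y - x| <= d.
Proof.
rewrite compact_cover => cK d0.
have [|y Ky|D DK KD] := cK X K (fun x => ball x d).
- by move=> x _; exact: ball_open.
- by exists y => //; exact: ballxx.
exists (enum_fset D) => [x xD|y /KD [x xD xy]]; first exact/set_mem/DK.
by exists x => //; move: xy; rewrite -ball_normE /= distrC => /ltW.
Qed.

Lemma seq_eventually (T : eqType) (s : seq T) (Q : T -> nat -> Prop) :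
  (forall x, x \in s -> exists N, forall n, (N <= n)%N -> Q x n) ->
  exists N, forall x n, x \in s -> (N <= n)%N -> Q x n.
Proof.
elim: s => [|x s IH] H; first by exists 0%N.
have [N1 H1] := H x (mem_head _ _).
have [|N2 H2] := IH; first by move=> y ys; apply: H; rewrite inE ys orbT.
exists (maxn N1 N2) => y n; rewrite inE geq_max => /predU1P[->|ys] /andP[n1 n2].
  exact: H1.
exact: H2.
Qed.

Lemma cvge0P {R : realType} (a : nat -> \bar R) : (forall n, 0 <= a n)%E ->
  a n @[n --> \oo] --> 0%E <->
  forall e : R, 0 < e -> exists N, forall n, (N <= n)%N -> (a n <= e%:E)%E.
Proof.
move=> a0; split => [acvg e e0|H A].
  have : \forall n \near \oo, (a n <= e%:E)%E.
    apply: (acvg [set x | (x <= e%:E)%E]) => /=.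
    have : nbhs (0 : R) (fun r => (r%:E <= e%:E)%E).
      apply/nbhs_ballP; exists e => //= r.
      rewrite /ball /= sub0r normrN lee_fin => /ltW; exact: le_trans (ler_norm r).
    exact.
  by case=> N _ HN; exists N => n Nn; exact: HN.
move=> A0; have /nbhs_ballP[e /= e0 eA] : nbhs (0 : R) (fun r => A r%:E) := A0.
(* The ball is open and [H] gives a non-strict bound, hence the half. *)
have [|N HN] := H (e / 2); first by rewrite divr_gt0.
exists N => // n /= Nn.
have := HN n Nn; have := a0 n; case: (a n) => [r| |]//.
rewrite !lee_fin => r0 re; apply: eA => /=.
by rewrite /ball /= sub0r normrN ger0_norm//; lra.
Qed.

(** * Stepanov convergence of translates; (i) and (ii) imply uniform almost automorphy *)

Section Stepanov_convergence.
Context {R : realType} {X : completeNormedModType R}.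
Implicit Types (u v w : R -> X) (f : R -> X -> X) (K : set X) (tau : R^nat).

Definition Sp_close (p t e a : R) u v :=
  (Sp_norm p t (fun s => u (s + a) - v s)%R <= e%:E)%E /\
  (Sp_norm p t (fun s => v (s - a) - u s)%R <= e%:E)%E.

Definition Sp_cvg (p : R) tau u v := forall t e : R, 0 < e ->
  exists N, forall n, (N <= n)%N -> Sp_close p t e (tau n) u v.

Lemma Sp_cvgP (p : R) tau u v : Sp_cvg p tau u v <-> forall t : R,
  Sp_norm p t (fun s => u (s + tau n) - v s) @[n --> \oo] --> 0%E /\
  Sp_norm p t (fun s => v (s - tau n) - u s) @[n --> \oo] --> 0%E.
Proof.
split => [H t|H t e e0].
  by split; apply/cvge0P => [n|e e0]; try exact: Sp_norm_ge0;
    have [N HN] := H t e e0; exists N => n /HN [].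
have [/cvge0P H1 /cvge0P H2] := H t.
have [|N1 {}H1] := H1 _ e e0; first by move=> n; exact: Sp_norm_ge0.
have [|N2 {}H2] := H2 _ e e0; first by move=> n; exact: Sp_norm_ge0.
exists (maxn N1 N2) => n; rewrite geq_max => /andP[n1 n2].
by split; [exact: H1|exact: H2].
Qed.

(** The hypothesis on [m] is the one produced by [diagonal_subsequence]; with [i = 0] it covers
    ordinary subsequences. *)
Lemma Sp_cvg_subsequence (p : R) tau tau' (m : nat -> nat) (i : nat) u v :
  Sp_cvg p tau u v ->
  (forall n, (i <= n)%N -> (n <= m n)%N /\ tau' n = tau (m n)) ->
  Sp_cvg p tau' u v.
Proof.
move=> H mP t e e0; have [N HN] := H t e e0.
exists (maxn i N) => n; rewrite geq_max => /andP[/mP[nm ->] Nn].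
exact/HN/(leq_trans Nn).
Qed.

Lemma sup_over_le K (N : X -> \bar R) (c : \bar R) : (0 <= c)%E ->
  (sup_over K N <= c)%E <-> (forall x, K x -> (N x <= c)%E).
Proof.
move=> c0; split => [H x Kx|H].
  by apply: le_trans H; apply: ereal_sup_ubound; right; exists x.
by apply: ge_ereal_sup => _ [->//|[x Kx <-]]; exact: H.
Qed.

Lemma sup_over_ge0 K (N : X -> \bar R) : (0 <= sup_over K N)%E.
Proof. by apply: ereal_sup_ubound; left. Qed.

Lemma sup_over_cvgP (p : R) tau f (g : R -> X -> X) K :
  (forall t e : R, 0 < e -> exists N, forall n x, (N <= n)%N -> K x ->
     Sp_close p t e (tau n) (f ^~ x) (g ^~ x)) <->
  forall t : R,
  sup_over K (fun x => Sp_norm p t (fun s => f (s + tau n) x - g s x))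
    @[n --> \oo] --> 0%E /\
  sup_over K (fun x => Sp_norm p t (fun s => g (s - tau n) x - f s x))
    @[n --> \oo] --> 0%E.
Proof.
split => [H t|H t e e0].
  by split; apply/cvge0P => [n|e e0]; try exact: sup_over_ge0;
    have [N HN] := H t e e0; exists N => n Nn; apply/sup_over_le;
    rewrite ?lee_fin ?ltW// => x /(HN _ _ Nn)[].
have [/cvge0P H1 /cvge0P H2] := H t.
have [|N1 {}H1] := H1 _ e e0; first by move=> n; exact: sup_over_ge0.
have [|N2 {}H2] := H2 _ e e0; first by move=> n; exact: sup_over_ge0.
have e0' : (0 <= e%:E)%E by rewrite lee_fin ltW.
exists (maxn N1 N2) => n x; rewrite geq_max => /andP[n1 n2] Kx.
split; first by move/(sup_over_le _ _ _ e0') : (H1 _ n1); apply.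
by move/(sup_over_le _ _ _ e0') : (H2 _ n2); apply.
Qed.

Lemma Sp_norm_trans_le (p t : R) v u z (a b : R) : 1 <= p ->
  strongly_measurable u -> strongly_measurable v -> strongly_measurable z ->
  (Sp_norm p t (fun s => (u s - v s)%R) <= a%:E)%E ->
  (Sp_norm p t (fun s => (v s - z s)%R) <= b%:E)%E ->
  (Sp_norm p t (fun s => (u s - z s)%R) <= (a + b)%:E)%E.
Proof.
move=> p1 mu mv mz ua vb; apply: le_trans (Sp_norm_trans p t v u z p1 mu mv mz) _.
by rewrite EFinD leeD.
Qed.

Lemma Sp_norm_shiftB (p t a : R) u v :
  strongly_measurable u -> strongly_measurable v ->
  Sp_norm p t (fun s => u (s + a) - v (s + a)) =
  Sp_norm p (t + a) (fun s => u s - v s).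
Proof.
move=> mu mv; rewrite -(Sp_norm_shift p t a (fun s => u s - v s))//.
exact: strongly_measurableB.
Qed.

(* The limit of a family of translates inherits the modulus of continuity of the
   family. *)
Lemma Sp_cvg_dist (p d : R) tau u1 v1 u2 v2 : 1 <= p -> 0 < d ->
  strongly_measurable u1 -> strongly_measurable v1 ->
  strongly_measurable u2 -> strongly_measurable v2 ->
  Sp_cvg p tau u1 v1 -> Sp_cvg p tau u2 v2 ->
  (forall t, Sp_norm p t (fun s => u1 s - u2 s)%R <= d%:E)%E ->
  forall t, (Sp_norm p t (fun s => v1 s - v2 s)%R <= (3 * d)%:E)%E.
Proof.
move=> p1 d0 mu1 mv1 mu2 mv2 c1 c2 u12 t.
have [N1 H1] := c1 t d d0; have [N2 H2] := c2 t d d0.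
pose n := maxn N1 N2.
have [{}H1 _] := H1 n (leq_maxl _ _); have [{}H2 _] := H2 n (leq_maxr _ _).
have mu1' := strongly_measurable_shift (tau n) _ mu1.
have mu2' := strongly_measurable_shift (tau n) _ mu2.
have E := Sp_norm_shiftB p t (tau n) _ _ mu1 mu2.
have := u12 (t + tau n); rewrite -{}E => H12.
rewrite Sp_norm_distC in H1.
have H := Sp_norm_trans_le p t _ _ _ _ _ p1 mu1' mu2' mv2 H12 H2.
have := Sp_norm_trans_le p t _ _ _ _ _ p1 mv1 mu1' mv2 H1 H.
by rewrite (_ : d + (d + d) = 3 * d); last lra.
Qed.

(** Extract for one point of the list after the other; the limits already found survive later
    extractions. This is one stage of the diagonal argument. *)
Lemma AASp_subsequences_of_seq (p : R) f (s : seq X) tau :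
  (forall x, AASp p (f ^~ x)) ->
  exists2 k : nat -> nat, {homo k : m n / (m < n)%N} &
    forall x, x \in s -> exists2 v, Lploc p v & Sp_cvg p (tau \o k) (f ^~ x) v.
Proof.
move=> fA; elim: s => [|x s [k hk IH]]; first by exists id.
have [_ /(_ (tau \o k))[k' [v [hk' Lv /Sp_cvgP vP]]]] := fA x.
exists (k \o k') => [m n mn /=|y]; first exact/hk/hk'.
rewrite inE => /predU1P[->|/IH[w Lw wP]]; first by exists v.
exists w; first exact: Lw.
apply: (@Sp_cvg_subsequence _ _ _ k' 0 _ _ wP) => n _.
by split; [exact: homo_ltn_ge|].
Qed.

Lemma AASpU_of_AASp (p : R) f : 1 <= p ->
  (forall x, AASp p (f ^~ x)) -> Sp_uniformly_continuous_on_compacts p f ->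
  AASpU p f.
Proof.
move=> p1 fA fU.
have fL x : Lploc p (f ^~ x) by case: (fA x).
have fm x : strongly_measurable (f ^~ x) by case: (fL x).
split=> // K cK sigma.
have /choice[F FP] : forall j : nat, exists s : seq X,
    (forall x, x \in s -> K x) /\
    forall y, K y -> exists2 x, x \in s & `|y - x| <= j.+1%:R^-1.
  by move=> j; have [||s] := @compact_net _ _ K j.+1%:R^-1 => //; exists s.
pose P (j : nat) tau := forall x, x \in F j ->
  exists2 v, Lploc p v & Sp_cvg p tau (f ^~ x) v.
have [|i tau tau' m Pt mP x xF|k hk kP] := @diagonal_subsequence R sigma P.
- by move=> i tau; exact: AASp_subsequences_of_seq.
- have [v Lv vP] := Pt x xF; exists v; first exact: Lv.
  exact: Sp_cvg_subsequence vP mP.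
have /choice[v vP] : forall x, exists v, Lploc p v /\
    exists2 k' : nat -> nat, {homo k' : m n / (m < n)%N} &
      Sp_cvg p (sigma \o k \o k') (f ^~ x) v.
  move=> x; have [_ /(_ (sigma \o k))[k' [v [hk' Lv vP]]]] := fA x.
  by exists v; split => //; exists k' => //; exact/Sp_cvgP.
have vm x : strongly_measurable (v x) by case: (vP x) => -[].
exists k, (fun s x => v x s); split; [exact: hk|by move=> x; case: (vP x)|].
apply/(sup_over_cvgP p (sigma \o k)) => t e e0.
(* One fifth for [f] between x and a net point y, one for the convergence at y, and three for the
   limits at x and y, by [Sp_cvg_dist]. *)
pose d := e / 5; have d0 : 0 < d by rewrite divr_gt0.
have [dl dl0 dlP] := fU K cK d d0.
have [j jdl] : exists j : nat, j.+1%:R^-1 <= dl.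
  have [N _ NP] := near_infty_natSinv_lt (PosNum dl0).
  by exists N; exact/ltW/NP/leqnn.
have [FK Fnet] := FP j.
(* [w] selects the limits at the net points; elsewhere its value 0 is a dummy. *)
have /choice[w wP] : forall x, exists w, x \in F j ->
    strongly_measurable w /\ Sp_cvg p (sigma \o k) (f ^~ x) w.
  move=> x; have [xF|xF] := boolP (x \in F j); last by exists (cst 0).
  by have [w [mw _] wP] := kP j x xF; exists w.
have [N NP] := seq_eventually _ (F j)
  (fun x n => Sp_close p t d (sigma (k n)) (f ^~ x) (w x))
  (fun x xF => (wP x xF).2 t d d0).
exists N => n x Nn Kx.
have [y yF xy] := Fnet x Kx.
have [mw wc] := wP y yF.
have fxy t' : (Sp_norm p t' (fun s => f s x - f s y)%R <= d%:E)%E.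
  by apply: dlP => //; [exact: FK|exact: le_trans jdl].
have [_ [k' hk' vc]] := vP x.
(* The limits at x and y can be compared only along a common sequence, so the convergence at y is
   restricted to the subsequence [k'] belonging to x. *)
have wc' : Sp_cvg p (sigma \o k \o k') (f ^~ y) (w y).
  apply: (@Sp_cvg_subsequence _ _ _ k' 0 _ _ wc) => q _.
  by split; [exact: homo_ltn_ge|].
have vxy := Sp_cvg_dist p d _ _ _ _ _ p1 d0 (fm x) (vm x) (fm y) mw vc wc' fxy.
have [yN1 yN2] := NP y n yF Nn.
have m1 := strongly_measurable_shift (sigma (k n)) _ (fm x).
have m2 := strongly_measurable_shift (sigma (k n)) _ (fm y).
have m3 := strongly_measurable_shift (- sigma (k n)) _ (vm x).
have m4 := strongly_measurable_shift (- sigma (k n)) _ mw.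
have eE : d + (d + 3 * d) = e by rewrite /d; lra.
split.
  (* The chain goes from the translate of [f] at x to its translate at y, then to [w y], then to
     [v x]. The second half goes from the translate of [v x] to that of [w y], then to [f] at y,
     then to [f] at x. *)
  have H1 := fxy (t + sigma (k n)).
  rewrite -(Sp_norm_shiftB _ _ _ _ _ (fm x) (fm y)) in H1.
  have H2 := vxy t; rewrite Sp_norm_distC in H2.
  have H := Sp_norm_trans_le p t _ _ _ _ _ p1 m2 mw (vm x) yN1 H2.
  have := Sp_norm_trans_le p t _ _ _ _ _ p1 m1 m2 (vm x) H1 H.
  by rewrite eE.
have H1 := vxy (t - sigma (k n)).
rewrite -(Sp_norm_shiftB _ _ _ _ _ (vm x) mw) in H1.
have H2 := fxy t; rewrite Sp_norm_distC in H2.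
have H := Sp_norm_trans_le p t _ _ _ _ _ p1 m4 (fm y) (fm x) yN2 H2.
have := Sp_norm_trans_le p t _ _ _ _ _ p1 m3 m4 (fm x) H1 H.
by rewrite (_ : 3 * d + (d + d) = e); last by rewrite -eE; lra.
Qed.

End Stepanov_convergence.

(** * Tonelli's theorem on rectangles and averaging over a parameter *)

Section tonelli.
Local Open Scope ereal_scope.
Context d1 d2 (T1 : measurableType d1) (T2 : measurableType d2) (R : realType).
Variable m1 : {sigma_finite_measure set T1 -> \bar R}.
Variable m2 : {sigma_finite_measure set T2 -> \bar R}.
Variables (A : set T1) (B : set T2).
Hypotheses (mA : measurable A) (mB : measurable B).
Variable E : T1 * T2 -> \bar R.
Hypotheses (mE : measurable_fun [set: T1 * T2] E) (E0 : forall z, 0 <= E z).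

Lemma tonelli_on :
  \int[m1]_(x in A) \int[m2]_(y in B) E (x, y) =
  \int[m2]_(y in B) \int[m1]_(x in A) E (x, y).
Proof.
pose F := E \_ (A `*` B).
have mF : measurable_fun setT F.
  apply/(measurable_restrictT _ _).1; first exact: measurableX.
  exact: measurable_funTS.
have F0 z : 0 <= F z by exact: erestrict_ge0.
have FE x y : F (x, y) = if (x \in A) && (y \in B) then E (x, y) else 0.
  by rewrite /F patchE in_setX.
transitivity (\int[m1]_x \int[m2]_y F (x, y)).
  rewrite integral_mkcond; apply: eq_integral => x _; rewrite patchE.
  case: ifPn => xA.
    rewrite integral_mkcond; apply: eq_integral => y _.
    by rewrite patchE FE xA.
  by rewrite integral0_eq// => y _; rewrite FE (negbTE xA).
rewrite (fubini_tonelli F mF F0) [RHS]integral_mkcond.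
apply: eq_integral => y _; rewrite patchE; case: ifPn => yB.
  rewrite [RHS]integral_mkcond; apply: eq_integral => x _.
  by rewrite patchE FE yB andbT.
by rewrite integral0_eq// => x _; rewrite FE (negbTE yB) andbF.
Qed.

(** Since [v x] is below [E (x, y)] for y in a set of measure at least r / 2, (r / 2) [v x] is below
    the integral of [E (x, y)] over y in [B]. Integrating in x and exchanging the integrals bounds
    the result by [V] times the measure of [B], hence by V r. *)
Lemma le_integral_averaging (v : T1 -> \bar R) (good : T1 -> set T2)
    (r V : R) :
  measurable_fun [set: T1] v -> (forall x, 0 <= v x) -> (0 < r)%R ->
  m2 B <= r%:E ->
  (forall x, A x -> [/\ measurable (good x), good x `<=` B &
     (r / 2)%:E <= m2 (good x)]) ->
  (forall x y, A x -> good x y -> v x <= E (x, y)) ->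
  (forall y, B y -> \int[m1]_(x in A) E (x, y) <= V%:E) -> (0 <= V)%R ->
  \int[m1]_(x in A) v x <= (2 * V)%:E.
Proof.
move=> mv v0 r0 Br goodP vE EV V0.
have mEx x : measurable_fun setT (fun y => E (x, y)).
  exact: measurableT_comp mE (measurable_pair1 x).
have H : (r / 2)%:E * \int[m1]_(x in A) v x <= (r / 2)%:E * (2 * V)%:E.
  rewrite -ge0_integralZl_EFin//; last 2 first.
  - exact: measurable_funTS.
  - by rewrite divr_ge0// ltW.
  apply: (@le_trans _ _ (\int[m1]_(x in A) \int[m2]_(y in B) E (x, y))).
    apply: le_ge0_integral => // x Ax.
      by rewrite mule_ge0// lee_fin divr_ge0// ltW.
    have [mg gB rg] := goodP x Ax.
    apply: (@le_trans _ _ (\int[m2]_(y in good x) cst (v x) y)).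
      by rewrite integral_cst// muleC lee_wpmul2l.
    apply: (@le_trans _ _ (\int[m2]_(y in good x) E (x, y))).
      by apply: le_ge0_integral => [//|y _|y gy]; [exact: v0|exact: (vE x y Ax gy)].
    by apply: ge0_subset_integral => //; exact: measurable_funTS.
  rewrite tonelli_on; apply: (@le_trans _ _ (\int[m2]_(y in B) cst V%:E y)).
    by apply: le_ge0_integral => // y _; exact: integral_ge0.
  rewrite integral_cst// -EFinM (_ : (r / 2 * (2 * V))%R = (V * r)%R); last by field.
  by rewrite EFinM lee_wpmul2l// lee_fin.
by rewrite lee_pmul2l// in H; rewrite lte_fin divr_gt0.
Qed.

(** The partial integral is measurable in y by Tonelli's theorem. This serves to show that the sets
    of close translations are measurable. *)
Lemma measurable_sublevel_integral (c : R) :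
  measurable [set y | \int[m1]_(x in A) E (x, y) <= c%:E].
Proof.
pose F := E \_ (A `*` [set: T2]).
have mF : measurable_fun setT F.
  apply/(measurable_restrictT _ _).1; first exact: measurableX.
  exact: measurable_funTS.
have F0 z : 0 <= F z by exact: erestrict_ge0.
have := measurable_fun_fubini_tonelli_G (m1 := m1) F mF F0 measurableT _
  (emeasurable_itv `]-oo, c%:E]).
rewrite setTI; congr (measurable _); apply/seteqP; split => y /=;
  rewrite in_itv/= /fubini_G.
  rewrite [in X in _ -> X]integral_mkcond; congr (_ <= _).
  apply: eq_integral => x _.
  by rewrite /F !patchE in_setX in_setT andbT.
rewrite [in X in X -> _]integral_mkcond; congr (_ <= _).
apply: eq_integral => x _.
by rewrite /F !patchE in_setX in_setT andbT.
Qed.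

End tonelli.

(** * Averaging over a set of translations of positive measure *)

Section translation_average.
Context {R : realType}.
Local Notation mu := (@lebesgue_measure R).

(** [x] is at most twice the larger of [y] and [d], and the power of the larger is at most the sum
    of the powers. *)
Lemma powRD_le (p x y d : R) : 0 <= p -> 0 <= x -> 0 <= y -> 0 <= d ->
  x <= y + d -> x `^ p <= 2 `^ p * (y `^ p + d `^ p).
Proof.
move=> p0 x0 y0 d0 xyd; have p2 : 0 <= 2 `^ p :> R by exact: powR_ge0.
have H z : 0 <= z -> x <= 2 * z -> x `^ p <= 2 `^ p * z `^ p.
  move=> z0 xz; rewrite -powRM//.
  by apply: ge0_ler_powR => //; rewrite nnegrE// mulr_ge0.
have [yd|dy] := leP y d.
  apply: (le_trans (H d d0 _)); first by lra.
  by rewrite ler_wpM2l// lerDr powR_ge0.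
apply: (le_trans (H y y0 _)); first by lra.
by rewrite ler_wpM2l// lerDl powR_ge0.
Qed.

Lemma uniform_cvg0_small (w : nat -> R -> R) (D : set R) (h : R) : 0 < h ->
  {uniform D, w @ \oo --> (cst 0 : R -> R)} ->
  exists n, forall s, D s -> `|w n s| <= h.
Proof.
move=> h0 wD.
have [N _ NP] : \forall n \near \oo, forall s, D s -> `|w n s| <= h.
  apply: (wD [set g | forall s, D s -> `|g s| <= h]).
  apply/uniform_nbhs; exists [set z | ball z.1 h z.2].
  split; first exact: (entourage_ball _ (PosNum h0)).
  by move=> g /= gD s Ds; move: (gD s Ds); rewrite /ball /= sub0r normrN => /ltW.
by exists N; apply: NP => /=.
Qed.

Lemma measurable_translation_diff (p t : R) (w : R -> R) :
  measurable_fun [set: R] w ->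
  measurable_fun [set: R * R]
    (fun z : R * R => (`|w (z.1 + z.2) - w (z.1 + t)| `^ p)%:E).
Proof.
move=> mw; apply/measurable_EFinP.
apply: (measurableT_comp (measurable_powR p)).
apply: measurableT_comp => //; apply: measurable_funB.
  by apply: (measurableT_comp mw); exact: measurable_funD.
by apply: (measurableT_comp mw); exact: measurable_funD.
Qed.

(** By Egorov's theorem some [w n] is small off a set [B] of measure below half that of [S]. For
    each s, at least half of the x in [S] put s + x outside [B], where [w n (s + t)] is bounded by
    the difference of the two translates plus a small constant. Averaging over these x gives the
    estimate. *)
Lemma translation_average (p a b c t : R) (w : nat -> R -> R) (S : set R) :
  0 < p -> a <= b -> 0 < c ->
  (forall n, measurable_fun [set: R] (w n)) -> (forall n s, 0 <= w n s) ->
  {ae mu, forall s, w ^~ s @ \oo --> (0 : R)} ->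
  measurable S -> S `<=` `[0, 1] -> (0 < mu S)%E ->
  (forall n x, S x ->
    (\int[mu]_(s in `[a, b]) (`|w n (s + x)%R - w n (s + t)%R| `^ p)%:E
       <= c%:E)%E) ->
  exists n, (\int[mu]_(s in `[a, b]) (w n (s + t)%R `^ p)%:E
    <= (2 * (2 `^ p * (c + c)))%:E)%E.
Proof.
move=> p0 ab c0 mw w0 wcvg mS S01 S0 Sc.
have S1 : (mu S <= 1)%E.
  apply: (@le_trans _ _ (mu `[0, 1]%classic)); last first.
    by rewrite lebesgue_measure_itv/= lte_fin ltr01 sube0.
  by apply: (@le_measure _ _ _ mu) => //; apply: mem_set.
pose r := fine (mu S).
have rE : mu S = r%:E.
  by rewrite fineK// ge0_fin_numE// (le_lt_trans S1)// ltry.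
have r0 : 0 < r by rewrite -lte_fin -rE.
(* Chosen so that h (b - a) is at most [c]; the added 1 keeps the denominator positive when a =
   b. *)
pose h := c / (b - a + 1).
have h0 : 0 < h by rewrite divr_gt0//; lra.
have hp0 : 0 < h `^ p^-1 by rewrite powR_gt0.
(* For s in [a, b] and x in [0, 1] the sum s + x lies in [a, b + 1], a set of finite measure as
   Egorov's theorem requires. *)
have [B [mB Br /(uniform_cvg0_small _ _ _ hp0)[n nP]]] :
    exists B, [/\ measurable B, (mu B < (r / 2)%:E)%E &
    {uniform `[a, b + 1] `\` B, w @ \oo --> (cst 0 : R -> R)}].
  apply: ae_pointwise_almost_uniform => //.

  - by move=> n; exact: (measurable_funTS (mw n)).
  - have J : (mu `[a, (b + 1)%R]%classic < +oo)%E.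
      by rewrite lebesgue_measure_itv/=; case: ifPn => _; rewrite -?EFinB ltry.
    exact: J.
  - by apply: ae_imply wcvg => s ws _.
  - by rewrite divr_gt0.
have muab : (mu `[a, b]%classic <= (b - a)%:E)%E.
  rewrite lebesgue_measure_itv/=; case: ifPn => _; first by rewrite EFinB.
  by rewrite lee_fin subr_ge0.
exists n.
pose E (z : R * R) : \bar R :=
  ((2 `^ p)%:E * (h%:E + (`|w n (z.1 + z.2)%R - w n (z.1 + t)%R| `^ p)%:E))%E.
pose good s := S `\` ((fun x => x + s) @^-1` B).
have mBs s : measurable ((fun x => x + s) @^-1` B).
  by rewrite -[X in measurable X]setTI; exact: measurable_shift.
have mwt : measurable_fun [set: R] (fun s => (w n (s + t) `^ p)%:E).
  apply: measurable_powR_EFin; apply: (measurableT_comp (mw n)).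
  exact: measurable_shift.
have mE : measurable_fun [set: R * R] E.
  apply: emeasurable_funM => //; apply: emeasurable_funD => //.
  exact: measurable_translation_diff.
have E0 z : (0 <= E z)%E.
  by rewrite mule_ge0// ?adde_ge0// lee_fin ?powR_ge0 ?ltW.
apply: (@le_integral_averaging _ _ (measurableTypeR R) (measurableTypeR R) R
  mu mu `[a, b]%classic S _ mS E mE E0 _ good r) => //.
- by move=> s; rewrite lee_fin powR_ge0.
- have Sr : (mu S <= r%:E)%E by rewrite rE.
  exact: Sr.
- move=> s _; split; [exact: (measurableD mS (mBs s))|exact: subDsetl|].
  (* A translate of [B] takes less than r / 2 away from [S], of measure r. *)
  rewrite -(@leeD2rE _ (r / 2)%:E)// -EFinD -splitr.
  have SE := measureDI mu mS (mBs s).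
  rewrite -(_ : mu S = r%:E)// [leLHS]SE; apply: leeD; first exact: lexx.
  apply: le_trans (ltW Br).
  have <- := lebesgue_measure_shift s B mB.
  exact: (measureIr mu mS (mBs s)).
- move=> s x /=; rewrite in_itv/= => /andP[as_ sb] [Sx sxB].
  have /andP[x0 x1] : 0 <= x <= 1 by move: (S01 x Sx); rewrite /= in_itv.
  have wsx : w n (s + x) <= h `^ p^-1.
    rewrite -[leLHS]ger0_norm//; apply: nP; split.
      by rewrite /= in_itv/=; apply/andP; split; lra.
    by rewrite addrC.
  rewrite /E -EFinD -EFinM lee_fin /=.
  apply: (le_trans (powRD_le p _ (h `^ p^-1)
    `|w n (s + x) - w n (s + t)| _ _ _ _ _)) => //.
  + exact: ltW.
  + exact: ltW.
  + have := ler_norm (w n (s + t) - w n (s + x)); rewrite distrC; lra.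
  + by rewrite -powRrM mulVf ?gt_eqF// powRr1// ltW.
- move=> x Sx; rewrite /E /=.
  pose D s := ((`|w n (s + x) - w n (s + t)| `^ p)%:E : \bar R).
  have mD : measurable_fun `[a, b] D.
    have md : measurable_fun [set: R] (fun s => w n (s + x) - w n (s + t)).
      by apply: measurable_funB; apply: (measurableT_comp (mw n));
        exact: measurable_shift.
    have mnd : measurable_fun [set: R] (fun s => `|w n (s + x) - w n (s + t)|).
      exact: measurableT_comp md.
    exact: (measurable_funTS (measurable_powR_EFin p _ mnd)).
  have D0 s : `[a, b]%classic s -> (0 <= D s)%E by rewrite lee_fin powR_ge0.
  have mh : measurable_fun (`[a, b] : set R) (fun=> h%:E) by exact: measurable_cst.
  have hE0 s : `[a, b]%classic s -> (0 <= h%:E)%E by rewrite lee_fin ltW.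
  have hD0 s : `[a, b]%classic s -> (0 <= h%:E + D s)%E.
    by move=> sI; apply: adde_ge0; [exact: hE0 sI|exact: D0].
  have mI : measurable (`[a, b]%classic : set R) by exact: measurable_itv.
  have -> := ge0_integralZl_EFin mu mI hD0 (emeasurable_funD mh mD)
    (powR_ge0 _ _).
  have -> := ge0_integralD mu mI hE0 mh D0 mD.
  rewrite [leRHS]EFinM lee_wpmul2l ?lee_fin ?powR_ge0//.
  rewrite EFinD; apply: leeD; last exact: Sc.
  have -> := integral_cst mu mI h%:E.
  apply: (@le_trans _ _ (h%:E * (b - a)%:E)%E).
    by rewrite lee_wpmul2l ?lee_fin ?(ltW h0)//.
  rewrite -EFinM lee_fin /h mulrAC ler_pdivrMr; last by lra.
  by rewrite ler_wpM2l ?ltW//; lra.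
- by rewrite mulr_ge0 ?powR_ge0//; lra.
Qed.

End translation_average.

(** * Sequences chosen greedily, and cluster points in compact sets *)

Lemma avoiding_sequence (T : eqType) (A : T -> Prop) (bad : T -> T -> Prop) :
  (forall s : seq T, (forall y, y \in s -> A y) ->
     exists x, A x /\ forall y, y \in s -> ~ bad y x) ->
  exists sigma : nat -> T, (forall n, A (sigma n)) /\
    forall m n, (m < n)%N -> ~ bad (sigma m) (sigma n).
Proof.
(* The empty list supplies a default for [next] on lists that leave [A]. *)
move=> H; have [x0 _] : exists x, A x /\ forall y, y \in [::] -> ~ bad y x.
  exact: H.
have /choice[next nextP] : forall s : seq T, exists x,
    (forall y, y \in s -> A y) -> A x /\ forall y, y \in s -> ~ bad y x.
  move=> s; have [sA|] := pselect (forall y, y \in s -> A y).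
    by have [x xP] := H s sA; exists x.
  by move=> sA; exists x0 => /sA.
(* [L n] lists the first n terms; the next term is chosen to avoid all of them. *)
pose fix L n := if n is n'.+1 then next (L n') :: L n' else [::].
have LA n y : y \in L n -> A y.
  elim: n y => [//|n IH] y /=; rewrite inE => /predU1P[->|/IH//].
  by case: (nextP (L n) IH).
exists (fun n => next (L n)); split; first by move=> n; case: (nextP _ (LA n)).
move=> m n mn; have [_] := nextP _ (LA n); apply.
elim: n mn => // n IH; rewrite ltnS leq_eqVlt => /predU1P[->|/IH] /=.
  exact: mem_head.
by rewrite inE => ->; rewrite orbT.
Qed.

Lemma cvg_reindex {T : topologicalType} (u : nat -> T) (h : nat -> nat)
    (z : T) :
  (forall n, (n <= h n)%N) -> u @ \oo --> z -> u (h n) @[n --> \oo] --> z.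
Proof.
move=> hn uz A /uz[N _ NP]; exists N => // n Nn.
by apply: NP => /=; exact: leq_trans Nn (hn n).
Qed.

(** For each j, pick a term of index at least j within 1 / (j + 1) of a cluster point. The indices
    tend to infinity but may repeat, which is all that [cvg_reindex] asks of a reindexing. *)
Lemma compact_cluster_sequence {R : realType} {X : normedModType R} (K : set X)
    (x : nat -> X) : compact K -> (forall n, K (x n)) ->
  exists (z : X) (k : nat -> nat), (forall j, (j <= k j)%N) /\
    x (k j) @[j --> \oo] --> z.
Proof.
move=> cK Kx.
have [|z [_ zx]] := cK (x @ \oo) _; first by exists 0%N => // n _; exact: Kx.
have /choice[k kP] : forall j : nat, exists n,
    (j <= n)%N /\ `|z - x n| < j.+1%:R^-1.
  move=> j.
  have [||y [[n /= jn <-] zy]] :=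
      zx (x @` [set n | (j <= n)%N]) (ball z j.+1%:R^-1).
  - by exists j => // n jn; exists n.
  - exact: nbhsx_ballx.
  by exists n; split => //; move: zy; rewrite -ball_normE.
exists z, k; split; first by move=> j; case: (kP j).
apply/cvgrPdist_lt => e e0.
have [N _ NP] := near_infty_natSinv_lt (PosNum e0).
by exists N => // j Nj; exact: lt_trans (kP j).2 (NP j Nj).
Qed.

(** * Continuity of [f] from compact sets into L^p of a window *)

Section continuity_in_Lp.
Context {R : realType} {X : completeNormedModType R}.
Local Notation mu := (@lebesgue_measure R).

(** A finite union of null sets is null, whereas [0, 1] has measure 1. This provides the choice
    required by [avoiding_sequence]. *)
Lemma null_sets_miss01 (S : R -> set R) (s : seq R) :
  (forall y, y \in s -> mu.-negligible (S y)) ->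
  exists x, `[0, 1]%classic x /\ forall y, y \in s -> ~ S y x.
Proof.
move=> Sn; apply: contrapT => /forallNP H.
have U : mu.-negligible [set x | exists2 y, y \in s & S y x].
  elim: s Sn {H} => [|y s IH] Sn.
    apply: (@negligibleS _ _ _ _ set0); last exact: negligible_set0.
    by move=> x [].
  have Sy : mu.-negligible (S y) by apply: Sn; exact: mem_head.
  have Ss : mu.-negligible [set x | exists2 y, y \in s & S y x].
    by apply: IH => y' ys; apply: Sn; rewrite inE ys orbT.
  apply: negligibleS (negligibleU Sy Ss) => x [y'].
  by rewrite inE => /predU1P[->|ys] Sx; [left|right; exists y'].
have I01 : mu.-negligible (`[0, 1]%classic : set R).
  apply: negligibleS U => x x01; apply: contrapT => xs; apply: (H x).
  by split => // y ys Sy; apply: xs; exists y.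
have [N [mN N0 IN]] := I01.
have : (mu `[0%R, 1%R]%classic <= 0)%E.
  by rewrite -[leRHS]N0; apply: (@le_measure _ _ _ mu) => //; apply: mem_set.
rewrite lebesgue_measure_itv/= lte_fin ltr01 sube0.
by rewrite lee_fin ler10.
Qed.

Lemma Sp_norm_leP (p t e : R) (u : R -> X) : 0 < p -> 0 <= e ->
  (Sp_norm p t u <= e%:E)%E <->
  (\int[mu]_(s in `[t, (t + 1)%R]) (`|u s| `^ p)%:E <= (e `^ p)%:E)%E.
Proof.
move=> p0 e0; rewrite /Sp_norm; set J := integral _ _ _.
have J0 : (0 <= J)%E by apply: integral_ge0 => s _; rewrite lee_fin powR_ge0.
have JE : J = ((J `^ p^-1) `^ p)%E by rewrite -poweRrM mulVf ?gt_eqF// poweRe1.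
have eE : e%:E = ((e `^ p)%:E `^ p^-1)%E.
  by rewrite poweR_EFin -powRrM mulfV ?gt_eqF// powRr1.
have mono (r : R) (a b : \bar R) : 0 <= r -> (0 <= a)%E -> (a <= b)%E ->
    (a `^ r <= b `^ r)%E.
  move=> r0 a0 ab; apply: gt0_ler_poweR => //; rewrite in_itv/= leey andbT//.
  exact: le_trans ab.
split => H.
  rewrite JE -poweR_EFin; apply: mono; [exact: ltW|exact: poweR_ge0|exact: H].
by rewrite eE; apply: mono; rewrite ?invr_ge0 ?(ltW p0).
Qed.

(** Closeness of translations is measured on an interval of length 2, while Stepanov norms control
    windows of length 1. *)
Lemma integral_two_windows_le (t : R) (h : R -> \bar R) :
  measurable_fun [set: R] h -> (forall s, 0 <= h s)%E ->
  (\int[mu]_(s in `[(t - 1)%R, (t + 1)%R]) h s <=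
   \int[mu]_(s in `[(t - 1)%R, (t - 1 + 1)%R]) h s +
   \int[mu]_(s in `[t, (t + 1)%R]) h s)%E.
Proof.
move=> mh h0; rewrite subrK.
have -> : `[t - 1, t + 1]%classic = `[t - 1, t] `|` `]t, t + 1] :> set R.
  apply/seteqP; split => s /=; rewrite !in_itv/=.
    by move=> /andP[s1 s2]; case: (leP s t) => st; [left|right]; rewrite ?s1 ?s2.
  by case=> /andP[s1 s2]; apply/andP; split; lra.
have m1 : measurable (`[t - 1, t]%classic : set R) by exact: measurable_itv.
have m2 : measurable (`]t, t + 1]%classic : set R) by exact: measurable_itv.
have m3 : measurable (`[t, t + 1]%classic : set R) by exact: measurable_itv.
have -> := ge0_integral_setU mu m1 m2 (measurable_funTS mh) (fun s _ => h0 s).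
  apply: leeD; first exact: lexx.
  apply: (ge0_subset_integral mu m2 m3 (measurable_funTS mh) (fun s _ => h0 s)).
  by move=> s /=; rewrite !in_itv/= => /andP[s1 ->]; rewrite ltW.
apply/disj_setPS => s [] /=; rewrite !in_itv/= => /andP[_ s1] /andP[s2 _].
by move: (lt_le_trans s2 s1); rewrite ltxx.
Qed.

Lemma Sp_norm_shift_close (p t d a b : R) (u v : R -> X) : 1 <= p ->
  strongly_measurable u -> strongly_measurable v ->
  Sp_close p t d a u v -> Sp_close p t d b u v ->
  (Sp_norm p t (fun s => u (s + a) - u (s + b))%R <= (d + d)%:E)%E.
Proof.
move=> p1 mu_ mv [ua _] [ub _]; rewrite Sp_norm_distC in ub.
have ma := strongly_measurable_shift a _ mu_.
have mb := strongly_measurable_shift b _ mu_.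
exact: Sp_norm_trans_le p t _ _ _ _ _ p1 ma mv mb ua ub.
Qed.

Lemma AASpU_small_difference (p : R) (f : R -> X -> X) (K : set X)
    (x y : nat -> X) (z : X) (t e : R) : 1 <= p ->
  (forall s, continuous (f s)) -> AASpU p f -> compact K ->
  (forall n, K (x n)) -> (forall n, K (y n)) ->
  x @ \oo --> z -> y @ \oo --> z -> 0 < e ->
  exists n, (Sp_norm p t (fun s => f s (x n) - f s (y n))%R <= e%:E)%E.
Proof.
move=> p1 fc [fL fA] cK Kx Ky xz yz e0; apply: contrapT => /forallNP Hbig.
have p0 : 0 < p by exact: lt_le_trans p1.
have fm v : strongly_measurable (f ^~ v) by case: (fL v).
have /choice[w wP] : forall n, exists w : R -> R,
    [/\ measurable_fun [set: R] w, forall s, 0 <= w s &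
      {ae mu, forall s, w s = `|f s (x n) - f s (y n)|}].
  move=> n; apply: (strongly_measurable_norm (fun s => f s (x n) - f s (y n))).
  exact: (strongly_measurableB (f ^~ (x n)) (f ^~ (y n))).
have mw n : measurable_fun [set: R] (w n) by case: (wP n).
have w0 n s : 0 <= w n s by case: (wP n).
have wE n : {ae mu, forall s, w n s = `|f s (x n) - f s (y n)|} by case: (wP n).
have wcvg : {ae mu, forall s, w ^~ s @ \oo --> (0 : R)}.
  apply: ae_imply (ae_foralln wE) => s ws.
  rewrite (_ : w ^~ s = fun n => `|f s (x n) - f s (y n)|); last first.
    by apply/funext => n; exact: ws.
  have fx : f s (x n) @[n --> \oo] --> f s z by apply: cvg_comp xz (fc s z).
  have fy : f s (y n) @[n --> \oo] --> f s z by apply: cvg_comp yz (fc s z).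
  have := cvg_norm (cvgB fx fy); rewrite subrr normr0.
  exact.
(* With this [c] the bound of [translation_average] is exactly the p-th power of [e]. *)
pose c := e `^ p / (4 * 2 `^ p).
have p2 : 0 < 2 `^ p :> R by rewrite powR_gt0.
have ep0 : 0 < e `^ p by rewrite powR_gt0.
have c0 : 0 < c by rewrite divr_gt0// mulr_gt0.
have cE : 2 * (2 `^ p * (c + c)) = e `^ p by rewrite /c; field; rewrite gt_eqF.
(* For every b in [0, 1], the s with s + b in [t, t + 1] lie in [t - 1, t + 1], so one interval
   serves all b. *)
pose D n a b :=
  (\int[mu]_(s in `[(t - 1)%R, (t + 1)%R])
     (`|w n (s + a)%R - w n (s + b)%R| `^ p)%:E)%E.
pose S b := `[0, 1]%classic `&` \bigcap_n [set a | (D n a b <= c%:E)%E].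
have mI : measurable (`[t - 1, t + 1]%classic : set R) by exact: measurable_itv.
have mS b : measurable (S b).
  apply: measurableI; first exact: measurable_itv.
  apply: bigcapT_measurable => n.
  apply: (@measurable_sublevel_integral _ _ (measurableTypeR R)
    (measurableTypeR R) R mu `[t - 1, t + 1]%classic mI
    (fun z : R * R => (`|w n (z.1 + z.2) - w n (z.1 + b)| `^ p)%:E)).
  - exact: measurable_translation_diff.
  - by move=> z'; rewrite lee_fin powR_ge0.
have S0 b : `[0, 1]%classic b -> mu (S b) = 0%E.
  rewrite /= in_itv/= => /andP[b0 b1]; apply: contrapT => /eqP Sb.
  have {}Sb : (0 < mu (S b))%E by rewrite lt0e Sb measure_ge0.
  have ab : t - 1 <= t + 1 by lra.
  have Sb01 : S b `<=` `[0, 1] by move=> a [].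
  have Sbc n a : S b a -> (D n a b <= c%:E)%E by move=> [_ Sa]; exact: Sa.
  have [n] := translation_average p (t - 1) (t + 1) c b w (S b) p0 ab c0 mw w0
    wcvg (mS b) Sb01 Sb Sbc.
  rewrite cE => wn; apply: (Hbig n); apply: (Sp_norm_leP p t e _ p0 (ltW e0)).2.
  have mwp := measurable_powR_EFin p _ (mw n).
  rewrite (_ : integral _ _ _ =
    (\int[mu]_(s in `[t, (t + 1)%R]) (w n s `^ p)%:E)%E); last first.
    apply: ae_eq_ge0_integral.
    - by [].
    - by move=> s _; rewrite lee_fin powR_ge0.
    - by move=> s _; rewrite lee_fin powR_ge0.
    - by move: (wE n); apply: ae_imply => s -> _.
  apply: le_trans wn.
  have := ge0_integral_shift b (t - b) _ mwp (fun s => powR_ge0 _ _).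
  rewrite subrK => <-.
  apply: ge0_subset_integral => //.
  - apply: measurable_funTS; apply: (measurableT_comp mwp).
    exact: measurable_shift.
  - by move=> s _; rewrite lee_fin powR_ge0.
  - by move=> s /=; rewrite !in_itv/= => /andP[s1 s2]; apply/andP; split; lra.
have [|sigma [s01 sS]] := avoiding_sequence R (fun a => `[0, 1]%classic a) S.
  move=> l lP; apply: null_sets_miss01 => b bl.
  by exists (S b); split; [exact: mS|exact: (S0 b (lP b bl))|exact: subset_refl].
have {fA} [k [g [hk gL /(sup_over_cvgP p (sigma \o k))gP]]] := fA K cK sigma.
(* Two copies of [d] compare two translates at one point, hence four at the points [x n] and [y n];
   the p-th power of their sum is c / 2, one half for each of the two windows. *)
pose d := (c / 2) `^ p^-1 / 4.
have d0 : 0 < d by rewrite divr_gt0 ?powR_gt0 ?divr_gt0.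
have [N1 H1] := gP (t - 1) d d0; have [N2 H2] := gP t d d0.
pose N := maxn N1 N2.
have kN : (k N < k N.+1)%N by exact: hk.
have gm v : strongly_measurable (g ^~ v) by case: (gL v).
pose a := sigma (k N.+1); pose b := sigma (k N).
have close v : K v -> forall t', t' = t - 1 \/ t' = t ->
    (Sp_norm p t' (fun s => f (s + a) v - f (s + b) v)%R <= (d + d)%:E)%E.
  move=> Kv t' tt'; apply: (Sp_norm_shift_close _ _ _ _ _ _ _ p1 (fm v) (gm v)).
    case: tt' => ->; first by apply: H1 => //; rewrite ltnW// ltnS leq_maxl.
    by apply: H2 => //; rewrite ltnW// ltnS leq_maxr.
  case: tt' => ->; first by apply: H1 => //; rewrite leq_maxl.
  by apply: H2 => //; rewrite leq_maxr.
(* It remains to show that the translations [a] and [b] are close, against the choice of [sigma]. *)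
apply: (sS _ _ kN); split; first exact: s01.
move=> n _ /=; rewrite /D -/a -/b.
have window t' : t' = t - 1 \/ t' = t ->
    (\int[mu]_(s in `[t', (t' + 1)%R])
       (`|w n (s + a)%R - w n (s + b)%R| `^ p)%:E
      <= (c / 2)%:E)%E.
  move=> tt'.
  have mfa v := strongly_measurable_shift a _ (fm v).
  have mfb v := strongly_measurable_shift b _ (fm v).
  have md v := strongly_measurableB _ _ (mfa v) (mfb v).
  (* Grouped by translation, the norm of [U] dominates the difference of the translates of [w n];
     regrouped by point, [U] splits into two differences bounded by [close]. *)
  pose U s := (f (s + a) (x n) - f (s + a) (y n)) -
              (f (s + b) (x n) - f (s + b) (y n)).
  have UE s : U s = (f (s + a) (x n) - f (s + b) (x n)) -
      (f (s + a) (y n) - f (s + b) (y n)).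
    by rewrite /U !opprB addrACA [RHS]addrACA [- _ + _]addrC.
  have HU : (Sp_norm p t' U <= ((d + d) + (d + d))%:E)%E.
    apply: le_trans (Sp_norm_triangle p t' _ _ U p1 (md (x n)) (md (y n)) _) _.
      by move=> s; rewrite UE; exact: ler_normB.
    by rewrite EFinD; apply: leeD; apply: close.
  have dE : ((d + d) + (d + d)) `^ p = c / 2.
    rewrite (_ : (d + d) + (d + d) = (c / 2) `^ p^-1); last by rewrite /d; field.
    by rewrite -powRrM mulVf ?gt_eqF// powRr1// ltW// divr_gt0.
  have dd0 : 0 <= (d + d) + (d + d) by lra.
  have {HU} := (Sp_norm_leP p t' _ U p0 dd0).1 HU; rewrite dE; apply: le_trans.
  apply: ae_le_ge0_integral.
  - by [].
  - by move=> s _; rewrite lee_fin powR_ge0.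
  - by move=> s _; rewrite lee_fin powR_ge0.
  - apply: ae_imply2 (ae_shift a _ (wE n)) (ae_shift b _ (wE n)) => s -> -> _.
    rewrite lee_fin; apply: ge0_ler_powR; rewrite ?nnegrE//; first exact: ltW.
    exact: ler_dist_dist.
have mD : measurable_fun [set: R]
    (fun s => (`|w n (s + a) - w n (s + b)| `^ p)%:E).
  have md : measurable_fun [set: R] (fun s => w n (s + a) - w n (s + b)).
    by apply: measurable_funB; apply: (measurableT_comp (mw n));
      exact: measurable_shift.
  have mnd : measurable_fun [set: R] (fun s => `|w n (s + a) - w n (s + b)|).
    exact: measurableT_comp md.
  exact: measurable_powR_EFin p _ mnd.
apply: le_trans (integral_two_windows_le t _ mD (fun s => powR_ge0 _ _)) _.
rewrite [c in leRHS]splitr EFinD.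
by apply: leeD; apply: window; [left|right].
Qed.

End continuity_in_Lp.

(** * Uniform almost automorphy implies (i) and (ii); the equivalence *)

Lemma AASp_of_AASpU {R : realType} {X : completeNormedModType R} (p : R)
    (f : R -> X -> X) (x : X) : AASpU p f -> AASp p (f ^~ x).
Proof.
move=> [fL fA]; split => [|sigma]; first exact: fL.
have c1 : compact [set x] by exact: compact_set1.
have [k [g [hk gL /(sup_over_cvgP p (sigma \o k)) gP]]] := fA [set x] c1 sigma.
exists k, (g ^~ x); split; [exact: hk|exact: gL|].
apply/(Sp_cvgP p (sigma \o k)) => t e e0; have [N NP] := gP t e e0.
by exists N => n Nn; exact: NP.
Qed.

Lemma AASpU_Sp_uniformly_continuous {R : realType} {X : completeNormedModType R}
    (p : R) (f : R -> X -> X) : 1 <= p -> (forall s, continuous (f s)) ->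
  AASpU p f -> Sp_uniformly_continuous_on_compacts p f.
Proof.
move=> p1 fc fAU K cK e e0; apply: contrapT => H.
have fm v : strongly_measurable (f ^~ v) by case: fAU => /(_ v)[].
(* [q n] packs two points within 1 / (n + 1) and the start of a window on which they violate
   (ii). *)
have /choice[q qP] : forall n : nat, exists q : X * X * R,
    [/\ K q.1.1, K q.1.2, `|q.1.1 - q.1.2| <= n.+1%:R^-1 &
      ~ (Sp_norm p q.2 (fun s => (f s q.1.1 - f s q.1.2)%R) <= e%:E)%E].
  move=> n; apply: contrapT => /forallNP Hn; apply: H; exists n.+1%:R^-1 => //.
  move=> x1 x2 K1 K2 x12 t; apply: contrapT => Ht.
  by apply: (Hn (x1, x2, t)).
have [z [j [jn xz]]] := compact_cluster_sequence K (fun n => (q n).1.1) cK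
  (fun n => let: And4 h _ _ _ := qP n in h).
pose x n := (q (j n)).1.1; pose y n := (q (j n)).1.2; pose tau n := (q (j n)).2.
have Kx n : K (x n) by case: (qP (j n)).
have Ky n : K (y n) by case: (qP (j n)).
have qbig n :
    ~ (Sp_norm p (tau n) (fun s => (f s (x n) - f s (y n))%R) <= e%:E)%E.
  by case: (qP (j n)).
have {}xz : x @ \oo --> z by exact: xz.
have yz : y @ \oo --> z.
  apply/cvgrPdist_lt => r r0; have r20 : 0 < r / 2 by rewrite divr_gt0.
  have [N1 _ N1P] := ((cvgrPdist_lt _ _).1 xz) _ r20.
  have [N2 _ N2P] := near_infty_natSinv_lt (PosNum r20).
  exists (maxn N1 N2) => // n; rewrite /= geq_max => /andP[n1 n2].
  have H1 : `|z - x n| < r / 2 := N1P n n1.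
  have H2 : `|x n - y n| < r / 2.
    have [_ _ xy _] := qP (j n); apply: le_lt_trans xy _.
    by apply: N2P; exact: leq_trans n2 (jn n).
  rewrite (splitr r) -(subrK (x n) z) -addrA.
  by rewrite (le_lt_trans (ler_normD _ _))// ltrD.
have [_ fA] := fAU.
have [k [g [hk gL /(sup_over_cvgP p (tau \o k)) gP]]] := fA K cK tau.
have gm v : strongly_measurable (g ^~ v) by case: (gL v).
(* Two fifths to change the translation at [x m], two at [y m], and one for the difference at the
   fixed translation. *)
pose d := e / 5; have d0 : 0 < d by rewrite divr_gt0.
(* The window at 0 suffices, since the translations [tau] carry it to the windows of the
   counterexample. *)
have [N NP] := gP 0 d d0.
have hkN n : (n <= k (n + N))%N.
  exact: leq_trans (leq_addr N n) (homo_ltn_ge _ hk _).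
(* From N on, all translates are close to the one by [tau (k N)], whose window is fixed, so
   continuity in L^p applies there. Adding N to the index keeps it in this range. *)
have [n] := AASpU_small_difference p f K (fun n => x (k (n + N)%N))
  (fun n => y (k (n + N)%N)) z (0 + tau (k N)) d p1 fc fAU cK
  (fun n => Kx _) (fun n => Ky _) (cvg_reindex _ _ _ hkN xz)
  (cvg_reindex _ _ _ hkN yz) d0.
set m := k (n + N)%N => mid; apply: (qbig m).
have close v : K v -> Sp_close p 0 d (tau m) (f ^~ v) (g ^~ v) /\
    Sp_close p 0 d (tau (k N)) (f ^~ v) (g ^~ v).
  by move=> Kv; split; apply: NP; rewrite ?leq_addl ?leqnn.
have [xm xN] := close _ (Kx m); have [ym yN] := close _ (Ky m).
have H1 := Sp_norm_shift_close _ _ _ _ _ _ _ p1 (fm (x m)) (gm (x m)) xm xN.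
have H2 := Sp_norm_shift_close _ _ _ _ _ _ _ p1 (fm (y m)) (gm (y m)) yN ym.
rewrite -(Sp_norm_shiftB _ _ _ _ _ (fm (x m)) (fm (y m))) in mid.
rewrite -[tau m]add0r -(Sp_norm_shiftB _ _ _ _ _ (fm (x m)) (fm (y m))).
have ms v a := strongly_measurable_shift a _ (fm v).
have H3 := Sp_norm_trans_le p 0 _ _ _ _ _ p1 (ms _ _) (ms _ _) (ms _ _) mid H2.
have := Sp_norm_trans_le p 0 _ _ _ _ _ p1 (ms _ _) (ms _ _) (ms _ _) H1 H3.
by rewrite (_ : d + d + (d + (d + d)) = e); last by rewrite /d; lra.
Qed.

Theorem lemma3p1 (R : realType) (X : completeNormedModType R) (p : R)
    (hp : 1 <= p) (f : R -> X -> X)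
    (hfc : forall t : R, continuous (f t))
    (hfL : forall x : X, Lploc p (f ^~ x)) :
  AASpU p f <->
  (forall x : X, AASp p (f ^~ x)) /\ Sp_uniformly_continuous_on_compacts p f.
Proof.
split=> [fA|[fA fU]]; last exact: AASpU_of_AASp.
split=> [x|]; first exact: AASp_of_AASpU.
exact: AASpU_Sp_uniformly_continuous.
Qed.
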